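(* Let $T>0$, $Q>0$, let the temporary impact be a constant $\eta>0$, and let the permanent impact $\theta:[0,T]\to(0,\infty)$ be continuously differentiable and decreasing. Let $\bar\theta=\max_{0\le t\le T}\max\{-\dot\theta_t,0\}$ and $\gamma=\frac{\bar\theta}{2\eta}$, and assume $\sqrt{\gamma}\,T<\pi$. Then the optimal solution $\zeta$ of the Optimal Execution Problem of maximizing $\mathcal{J}$ over $\Xi(Q)$ is non-negative. It exhibits at most two phases of execution: it is either monotonic, in which case transaction-triggered price manipulation is ruled out, or its velocity $\dot\zeta$ changes sign exactly once during execution. The optimal solution is always concave, and is bounded from below by TWAP: $\zeta_t\ge Q(1-t/T)$ for all $t\in[0,T]$.
   Context: $\Xi(Q)=\{\zeta\in\mathcal{C}^2([0,T]):\ \zeta_0=Q,\ \zeta_T=0\}$ and $$\mathcal{J}(\zeta)=\int_0^T\left(\theta_t\,\dot\zeta_t\,\zeta_t-\eta\,\dot\zeta_t^2\right)dt .$$ ''Decreasing'' means non-increasing. Monotonic means $\dot\zeta_t\le0$ for all $t$. The TWAP strategy is $t\mapsto Q(1-t/T)$. The model admits transaction-triggered price manipulation if there exist $Q>0$ and $\tilde\zeta\in\Xi(Q)$ with $\mathcal{J}(\tilde\zeta)>\sup\{\mathcal{J}(\zeta):\ \zeta\in\Xi(Q),\ \dot\zeta_t\le0\ \forall t\in[0,T]\}$. *)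

(* Defs.v *)
(* Stdlib reals and Coquelicot.  Functions on [0,T] are total functions R -> R
   of which only the values on [0,T] matter: continuity and differentiability
   are taken within [0,T], hence one-sided at the endpoints. *)
From Stdlib Require Import Reals Lra.
From Coquelicot Require Import Coquelicot.
Open Scope R_scope.

Definition Icc (a b : R) : R -> Prop := fun t => a <= t <= b.

(* Only meaningful when f is differentiable at t within D and t is an
   accumulation point of D; [C1_on] asserts this differentiability. *)
Definition Derive_in (D : R -> Prop) (f : R -> R) (t : R) : R :=
  iota (fun l : R => D_in f (fun _ => l) D t).

Definition C1_on (D : R -> Prop) (f : R -> R) : Prop :=
  forall t, D t ->
    D_in f (Derive_in D f) D t /\ continue_in (Derive_in D f) D t.

Definition C2_on (D : R -> Prop) (f : R -> R) : Prop :=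
  C1_on D f /\ C1_on D (Derive_in D f).

Definition decreasing_on (D : R -> Prop) (f : R -> R) : Prop :=
  forall s t, D s -> D t -> s <= t -> f t <= f s.

Definition concave_on (D : R -> Prop) (f : R -> R) : Prop :=
  forall x y l, D x -> D y -> 0 <= l <= 1 ->
    l * f x + (1 - l) * f y <= f (l * x + (1 - l) * y).

Definition is_max_on (D : R -> Prop) (f : R -> R) (m : R) : Prop :=
  (exists t, D t /\ f t = m) /\ (forall t, D t -> f t <= m).

(* Zeros of f, possibly filling an interval between two phases of opposite
   sign, are not counted. *)
Definition at_least_sign_changes (D : R -> Prop) (f : R -> R) (n : nat) : Prop :=
  exists t : nat -> R,
    (forall i, (i <= n)%nat -> D (t i)) /\
    (forall i, (i < n)%nat -> t i < t (S i) /\ f (t i) * f (t (S i)) < 0).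

Definition changes_sign_exactly_once (D : R -> Prop) (f : R -> R) : Prop :=
  at_least_sign_changes D f 1 /\ ~ at_least_sign_changes D f 2.

Definition velocity (T : R) (zeta : R -> R) : R -> R :=
  Derive_in (Icc 0 T) zeta.

Definition Xi (T Q : R) (zeta : R -> R) : Prop :=
  C2_on (Icc 0 T) zeta /\ zeta 0 = Q /\ zeta T = 0.

Definition J (T eta : R) (theta zeta : R -> R) : R :=
  RInt (fun t => theta t * velocity T zeta t * zeta t
                 - eta * (velocity T zeta t) ^ 2) 0 T.

Definition monotonic (T : R) (zeta : R -> R) : Prop :=
  forall t, Icc 0 T t -> velocity T zeta t <= 0.

Definition optimal (T eta : R) (theta : R -> R) (Q : R) (zeta : R -> R) : Prop :=
  Xi T Q zeta /\
  forall xi, Xi T Q xi -> J T eta theta xi <= J T eta theta zeta.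

Definition price_manipulation (T eta : R) (theta : R -> R) : Prop :=
  exists (Q : R) (xi : R -> R),
    0 < Q /\ Xi T Q xi /\
    Rbar_lt
      (Lub_Rbar (fun y => exists zeta,
         Xi T Q zeta /\ monotonic T zeta /\ y = J T eta theta zeta))
      (Finite (J T eta theta xi)).

Definition TWAP (T Q : R) : R -> R := fun t => Q * (1 - t / T).

(* Main.v *)
(* Write a = - theta' / (2 eta), so that 0 <= a <= gamma. Integrating theta zeta zeta' by parts
   turns J into a constant plus eta times the integral of a zeta^2 - zeta'^2, whose Euler-Lagrange
   equation is zeta'' = - a zeta. Since sqrt gamma T < PI, Wirtinger's inequality makes the
   quadratic form negative definite on functions vanishing at 0 and T; hence a solution of the
   boundary value problem is the unique maximizer. The same inequality on [0, t] shows that the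
   solution of the initial value problem at T has no other zero, so that it can be rescaled to
   solve the boundary value problem and is non-negative. Then zeta'' <= 0, which gives concavity,
   the TWAP bound and the single sign change; the maximizer being linear in Q, its monotonicity
   for one Q excludes price manipulation for all Q. *)
Require Import Defs.
From Stdlib Require Import Reals Lra Lia.
From Coquelicot Require Import Coquelicot.
Open Scope R_scope.

(** * Continuity and differentiation rules for real functions *)

Lemma continuous_Rplus (f g : R -> R) x :
  continuous f x -> continuous g x -> continuous (fun t => f t + g t) x.
Proof. exact (continuous_plus f g x). Qed.

Lemma continuous_Rminus (f g : R -> R) x :
  continuous f x -> continuous g x -> continuous (fun t => f t - g t) x.
Proof. exact (continuous_minus f g x). Qed.

Lemma continuous_Ropp (f : R -> R) x :
  continuous f x -> continuous (fun t => - f t) x.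
Proof. exact (continuous_opp f x). Qed.

Lemma continuous_Rmult (f g : R -> R) x :
  continuous f x -> continuous g x -> continuous (fun t => f t * g t) x.
Proof. exact (continuous_mult f g x). Qed.

Lemma continuous_Rdiv_const (f : R -> R) c x :
  continuous f x -> continuous (fun t => f t / c) x.
Proof.
intros Hf; unfold Rdiv; apply continuous_Rmult; [exact Hf | apply continuous_const].
Qed.

Lemma continuous_Rpow (f : R -> R) n x :
  continuous f x -> continuous (fun t => f t ^ n) x.
Proof.
intros Hf; induction n as [|n IH]; simpl.
- apply continuous_const.
- now apply continuous_Rmult.
Qed.

Lemma is_derive_continuous (f : R -> R) x l : is_derive f x l -> continuous f x.
Proof. intros H; apply (ex_derive_continuous f); now exists l. Qed.

Lemma is_derive_Rplus (f g : R -> R) x a b : is_derive f x a -> is_derive g x b ->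
  is_derive (fun t => f t + g t) x (a + b).
Proof. exact (is_derive_plus f g x a b). Qed.

Lemma is_derive_Rminus (f g : R -> R) x a b : is_derive f x a -> is_derive g x b ->
  is_derive (fun t => f t - g t) x (a - b).
Proof. exact (is_derive_minus f g x a b). Qed.

Lemma is_derive_Rscal (f : R -> R) c x a : is_derive f x a ->
  is_derive (fun t => c * f t) x (c * a).
Proof. exact (is_derive_scal f x c a). Qed.

Lemma is_derive_Rmult (f g : R -> R) x a b : is_derive f x a -> is_derive g x b ->
  is_derive (fun t => f t * g t) x (a * g x + f x * b).
Proof. intros Hf Hg; exact (is_derive_mult f g x a b Hf Hg Rmult_comm). Qed.

Lemma is_derive_Rsqr (f : R -> R) x a : is_derive f x a ->
  is_derive (fun t => f t ^ 2) x (2 * f x * a).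
Proof.
intros Hf; replace (2 * f x * a) with (INR 2 * a * f x ^ 1) by (simpl; ring).
exact (is_derive_pow f 2 x a Hf).
Qed.

Lemma continuous_continuity_pt (f : R -> R) x : continuous f x -> continuity_pt f x.
Proof. apply continuity_pt_filterlim. Qed.

(* Matching on the shape of the function keeps [apply] from unfolding real arithmetic. *)
Ltac continuity_R :=
  repeat match goal with
    | H : forall t, continuous ?f t |- continuous ?f _ => apply H
    | H : forall t, is_derive ?f t _ |- continuous ?f _ =>
        eapply is_derive_continuous; apply H
    | H : forall t, continuous ?f t |- continuous (fun t => ?f t) _ => apply H
    | H : forall t, is_derive ?f t _ |- continuous (fun t => ?f t) _ =>
        eapply is_derive_continuous; apply H
    | |- continuous (fun _ => ?c) ?x => exact (continuous_const c x)
    | |- continuous (fun t => t) ?x => exact (continuous_id x)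
    | |- continuous (fun t => @?f t + @?g t) ?x => apply (continuous_Rplus f g x)
    | |- continuous (fun t => @?f t - @?g t) ?x => apply (continuous_Rminus f g x)
    | |- continuous (fun t => @?f t * @?g t) ?x => apply (continuous_Rmult f g x)
    | |- continuous (fun t => - @?f t) ?x => apply (continuous_Ropp f x)
    | |- continuous (fun t => @?f t / ?c) ?x => apply (continuous_Rdiv_const f c x)
    | |- continuous (fun t => @?f t ^ ?n) ?x => apply (continuous_Rpow f n x)
    end.

(** * Integrals and primitives of continuous functions *)

Lemma ex_RInt_cont (f : R -> R) a b :
  (forall t, continuous f t) -> ex_RInt f a b.
Proof. intros Hf; apply (ex_RInt_continuous f); intros; apply Hf. Qed.

Lemma is_derive_RInt_cont (f : R -> R) a t :
  (forall s, continuous f s) -> is_derive (fun x => RInt f a x) t (f t).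
Proof.
intros Hf; apply (is_derive_RInt f (fun x => RInt f a x) a t); [|apply Hf].
apply filter_forall; intros x; apply (RInt_correct f); now apply ex_RInt_cont.
Qed.

Lemma RInt_antiderivative (f f' : R -> R) a b :
  (forall t, is_derive f t (f' t)) -> (forall t, continuous f' t) ->
  RInt f' a b = f b - f a.
Proof.
intros Hf Hc; apply is_RInt_unique.
apply (is_RInt_derive f f'); intros; [apply Hf | apply Hc].
Qed.

Lemma nondecreasing_of_derive (f f' : R -> R) a b : a <= b ->
  (forall t, a <= t <= b -> is_derive f t (f' t)) ->
  (forall t, a <= t <= b -> 0 <= f' t) -> f a <= f b.
Proof.
intros Hab Hd Hp.
destruct (MVT_gen f a b f') as [c [Hc E]].
- rewrite Rmin_left, Rmax_right by lra; intros x Hx; apply Hd; lra.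
- rewrite Rmin_left, Rmax_right by lra; intros x Hx.
  apply continuity_pt_filterlim; eapply is_derive_continuous; apply Hd; lra.
- rewrite Rmin_left, Rmax_right in Hc by lra.
  pose proof (Hp c Hc); nra.
Qed.

(** Serves to carry an identity from an open interval to its endpoints. *)
Lemma continuous_eq_adherent (f : R -> R) t c : continuous f t ->
  (forall e, 0 < e -> exists s, Rabs (s - t) < e /\ f s = c) -> f t = c.
Proof.
intros Hc H.
destruct (Req_dec (f t) c) as [E|N]; [exact E|exfalso].
assert (He : 0 < Rabs (f t - c)) by (apply Rabs_pos_lt; lra).
destruct (proj1 (filterlim_locally f (f t)) Hc (mkposreal _ He)) as [d Hd].
destruct (H d (cond_pos d)) as [s [Hs Es]].
specialize (Hd s Hs); change (Rabs (f s - f t) < Rabs (f t - c)) in Hd.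
rewrite Es, Rabs_minus_sym in Hd; lra.
Qed.

(** The primitive of [f ^ 2] is nondecreasing and starts at 0, so it vanishes on [[0, b]]. Its
    derivative [f ^ 2] is then 0 in the interior, and continuity settles the endpoints. *)
Lemma RInt_sqr_nonpos_eq_0 (f : R -> R) b : 0 < b ->
  (forall t, continuous f t) -> RInt (fun t => f t ^ 2) 0 b <= 0 ->
  forall t, 0 <= t <= b -> f t = 0.
Proof.
intros Hb Hf HI.
assert (Hc : forall t, continuous (fun t => f t ^ 2) t) by (intros; continuity_R).
pose (F := fun t => RInt (fun t => f t ^ 2) 0 t).
assert (HF : forall t, is_derive F t (f t ^ 2))
  by (intros t; now apply (is_derive_RInt_cont (fun t => f t ^ 2))).
assert (F0 : F 0 = 0) by (unfold F; exact (RInt_point 0 _)).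
assert (Fz : forall t, 0 <= t <= b -> F t = 0).
{ intros t Ht; apply Rle_antisym.
  - apply Rle_trans with (F b); [|exact HI].
    apply (nondecreasing_of_derive F (fun t => f t ^ 2)); [lra|intros; apply HF|].
    intros; apply pow2_ge_0.
  - rewrite <- F0.
    apply (nondecreasing_of_derive F (fun t => f t ^ 2)); [lra|intros; apply HF|].
    intros; apply pow2_ge_0. }
assert (Hint : forall t, 0 < t < b -> f t = 0).
{ intros t Ht.
  assert (E : f t ^ 2 = 0).
  { rewrite <- (is_derive_unique _ _ _ (HF t)).
    rewrite (Derive_ext_loc F (fun _ => 0)); [apply Derive_const|].
    assert (Hd : 0 < Rmin t (b - t)) by (apply Rmin_glb_lt; lra).
    exists (mkposreal _ Hd); intros y Hy; change (Rabs (y - t) < Rmin t (b - t)) in Hy.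
    apply Fz; pose proof (Rmin_l t (b - t)); pose proof (Rmin_r t (b - t)).
    apply Rabs_def2 in Hy; lra. }
  nra. }
intros t Ht; apply continuous_eq_adherent; [apply Hf|].
intros e He.
assert (Hm : 0 < Rmin (e / 2) (b / 2)) by (apply Rmin_glb_lt; lra).
pose proof (Rmin_l (e / 2) (b / 2)); pose proof (Rmin_r (e / 2) (b / 2)).
destruct (Rle_dec t (b / 2)).
- exists (t + Rmin (e / 2) (b / 2) / 2); split; [|apply Hint; lra].
  rewrite Rabs_pos_eq; lra.
- exists (t - Rmin (e / 2) (b / 2) / 2); split; [|apply Hint; lra].
  rewrite Rabs_left; lra.
Qed.

(** * Wirtinger's inequality *)

Lemma wirtinger (h h' : R -> R) b k : 0 < b -> 0 < k -> k * b < PI ->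
  (forall t, is_derive h t (h' t)) -> (forall t, continuous h' t) ->
  h 0 = 0 -> h b = 0 ->
  k ^ 2 * RInt (fun t => h t ^ 2) 0 b <= RInt (fun t => h' t ^ 2) 0 b.
Proof.
intros Hb Hk Hkb Hh Hc h0 hb.
(* [p = k cot (k t + d)] solves the Riccati equation [p' = - k ^ 2 - p ^ 2], so that
   [h' ^ 2 - k ^ 2 h ^ 2 = (h' - p h) ^ 2 + (p h ^ 2)'];
   the phase [d] keeps [k t + d] inside [(0, PI)]. *)
pose (d := (PI - k * b) / 2).
assert (Hs : forall t, 0 <= t <= b -> 0 < sin (k * t + d)).
{ intros t Ht; assert (0 <= k * t <= k * b) by nra.
  apply sin_gt_0; unfold d; lra. }
pose (p := fun t => k * cos (k * t + d) / sin (k * t + d)).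
assert (C1 : forall t, continuous (fun t => h' t ^ 2) t) by (intros; continuity_R).
assert (C2 : forall t, continuous (fun t => h t ^ 2) t) by (intros; continuity_R).
(* The last term vanishes at both ends, so [G 0 <= G b] is the claim. *)
pose (G := fun t => RInt (fun t => h' t ^ 2) 0 t - k ^ 2 * RInt (fun t => h t ^ 2) 0 t
                    - p t * h t ^ 2).
assert (HG : G 0 <= G b).
{ apply (nondecreasing_of_derive G (fun t => (h' t - p t * h t) ^ 2)); [lra| |].
  - intros t Ht; pose proof (Hs t Ht).
    pose proof (sin2_cos2 (k * t + d)) as SC; unfold Rsqr in SC.
    assert (Dp : is_derive p t (- k ^ 2 - p t ^ 2)).
    { unfold p; auto_derive; [lra|]; field_simplify; try lra; f_equal; ring. }
    unfold G; evar_last.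
    + apply is_derive_Rminus.
      * apply is_derive_Rminus.
        -- now apply (is_derive_RInt_cont (fun t => h' t ^ 2)).
        -- apply is_derive_Rscal; now apply (is_derive_RInt_cont (fun t => h t ^ 2)).
      * apply is_derive_Rmult; [exact Dp | apply is_derive_Rsqr, Hh].
    + simpl; ring.
  - intros; apply pow2_ge_0. }
unfold G in HG; rewrite h0, hb, !RInt_point in HG.
change (@zero R_CompleteNormedModule) with 0 in HG.
lra.
Qed.

(** * Retraction of the line onto [[0, T]] *)

(** Composition with this 1-Lipschitz map turns a function continuous within [[0, T]] into one
    continuous on all of [R], to which the two-sided calculus applies. *)
Definition clamp (T t : R) : R := Rmax 0 (Rmin t T).

Lemma clamp_id T t : 0 <= t <= T -> clamp T t = t.
Proof. intros H; unfold clamp; rewrite Rmin_left, Rmax_right; lra. Qed.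

Lemma clamp_bounds T t : 0 < T -> 0 <= clamp T t <= T.
Proof.
intros HT; unfold clamp, Rmax, Rmin.
destruct (Rle_dec t T); destruct (Rle_dec 0 _); lra.
Qed.

Lemma clamp_lipschitz T s t : 0 < T -> Rabs (clamp T s - clamp T t) <= Rabs (s - t).
Proof.
intros HT; unfold clamp, Rmax, Rmin.
destruct (Rle_dec s T), (Rle_dec t T); repeat destruct (Rle_dec 0 _);
  unfold Rabs; repeat destruct (Rcase_abs _); lra.
Qed.

Lemma continuous_clamp T t : 0 < T -> continuous (clamp T) t.
Proof.
intros HT; apply filterlim_locally; intros e.
exists e; intros y Hy; change (Rabs (y - t) < e) in Hy.
change (Rabs (clamp T y - clamp T t) < e).
pose proof (clamp_lipschitz T y t HT); lra.
Qed.

(** * Sequences with geometrically decaying increments *)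

Lemma is_lim_seq_div_pow2 K : is_lim_seq (fun n => K / 2 ^ n) 0.
Proof.
apply is_lim_seq_ext with (fun n => K * (/ 2) ^ n).
- intros n; rewrite pow_inv; reflexivity.
- replace (Finite 0) with (Rbar_mult K 0) by (simpl; f_equal; ring).
  apply is_lim_seq_scal_l, is_lim_seq_geom; rewrite Rabs_pos_eq; lra.
Qed.

Lemma geometric_Lim_seq (u : nat -> R) K :
  (forall n, Rabs (u (S n) - u n) <= K / 2 ^ n) ->
  forall n, Rabs (real (Lim_seq u) - u n) <= 2 * K / 2 ^ n.
Proof.
intros H.
(* [u n - e n] increases and [u n + e n] decreases, with the same limit. *)
pose (e := fun n => 2 * K / 2 ^ n).
assert (He : forall n, e n - e (S n) = K / 2 ^ n).
{ intros n; unfold e; simpl; field; apply pow_nonzero; lra. }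
assert (K0 : 0 <= K).
{ pose proof (H 0%nat) as H0; pose proof (Rabs_pos (u 1%nat - u 0%nat)); simpl in H0; lra. }
assert (Hpos : forall n, 0 <= e n).
{ intros n; unfold e; apply Rdiv_le_0_compat; [lra | apply pow_lt; lra]. }
assert (Hlo : forall n, u n - e n <= u (S n) - e (S n)).
{ intros n; pose proof (H n) as Hn; apply Rabs_le_between in Hn; specialize (He n); lra. }
assert (Hup : forall n, u (S n) + e (S n) <= u n + e n).
{ intros n; pose proof (H n) as Hn; apply Rabs_le_between in Hn; specialize (He n); lra. }
assert (Hup0 : forall n, u n + e n <= u 0%nat + e 0%nat).
{ induction n; [lra | specialize (Hup n); lra]. }
destruct (ex_finite_lim_seq_incr (fun n => u n - e n) (u 0%nat + e 0%nat)) as [l Hl];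
  [exact Hlo | intros n; specialize (Hup0 n); specialize (Hpos n); lra |].
assert (Le : is_lim_seq e 0) by exact (is_lim_seq_div_pow2 _).
assert (Lu : is_lim_seq u l).
{ apply is_lim_seq_ext with (fun n => (u n - e n) + e n); [intros; ring|].
  replace l with (l + 0) by ring; now apply is_lim_seq_plus'. }
assert (Lup : is_lim_seq (fun n => u n + e n) l).
{ replace l with (l + 0) by ring; now apply is_lim_seq_plus'. }
intros n; rewrite (is_lim_seq_unique _ _ Lu); simpl.
pose proof (is_lim_seq_incr_compare _ _ Hl Hlo n).
pose proof (is_lim_seq_decr_compare _ _ Lup Hup n).
apply Rabs_le_between; fold (e n); simpl in *; lra.
Qed.

Lemma geometric_bound_eq_0 x K : (forall n, Rabs x <= K / 2 ^ n) -> x = 0.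
Proof.
intros H.
assert (L : is_lim_seq (fun n => K / 2 ^ n) 0) by exact (is_lim_seq_div_pow2 _).
assert (Rbar_le (Rabs x) 0)
  by (eapply is_lim_seq_le; [exact H | apply is_lim_seq_const | exact L]).
simpl in *; pose proof (Rabs_pos x).
destruct (Req_dec x 0) as [E|N]; [exact E | pose proof (Rabs_pos_lt x N); lra].
Qed.

(** * Solving [z'' = - a z] by Picard iteration *)

Lemma exp_monotone x y : x <= y -> exp x <= exp y.
Proof.
intros [H|<-]; [left; now apply exp_increasing | right; reflexivity].
Qed.

(** Each integration gains a factor [1 / k] in the weighted norm: the bound is a primitive of
    [M * exp (k * t)], so its sum and its difference with [F] are nondecreasing, and both are
    nonnegative at 0. *)
Lemma primitive_exp_bound (F f : R -> R) T M k : 0 < k -> F 0 = 0 ->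
  (forall t, is_derive F t (f t)) ->
  (forall t, 0 <= t <= T -> Rabs (f t) <= M * exp (k * t)) ->
  forall t, 0 <= t <= T -> Rabs (F t) <= M / k * exp (k * t).
Proof.
intros Hk F0 HF Hf t Ht.
assert (HM : 0 <= M).
{ pose proof (Hf 0 ltac:(lra)) as H0; rewrite Rmult_0_r, exp_0 in H0.
  pose proof (Rabs_pos (f 0)); lra. }
assert (HMk : 0 <= M / k) by now apply Rdiv_le_0_compat.
assert (He : forall s, is_derive (fun s => M / k * exp (k * s)) s (M * exp (k * s))).
{ intros s; auto_derive; [easy|field; lra]. }
apply Rabs_le_between; split.
- assert (F 0 + M / k * exp (k * 0) <= F t + M / k * exp (k * t)).
  { apply (nondecreasing_of_derive (fun s => F s + M / k * exp (k * s))
             (fun s => f s + M * exp (k * s))); [lra| |].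
    - intros s Hs; apply is_derive_Rplus; [apply HF | apply He].
    - intros s Hs; pose proof (Hf s ltac:(lra)) as H; apply Rabs_le_between in H; lra. }
  rewrite Rmult_0_r, exp_0 in H; lra.
- assert (M / k * exp (k * 0) - F 0 <= M / k * exp (k * t) - F t).
  { apply (nondecreasing_of_derive (fun s => M / k * exp (k * s) - F s)
             (fun s => M * exp (k * s) - f s)); [lra| |].
    - intros s Hs; apply is_derive_Rminus; [apply He | apply HF].
    - intros s Hs; pose proof (Hf s ltac:(lra)) as H; apply Rabs_le_between in H; lra. }
  rewrite Rmult_0_r, exp_0 in H; lra.
Qed.

(** The fixed points of this operator solve [w'' = - a w] with [w 0 = 0] and [w' 0 = 1]. *)
Definition volterra (a w : R -> R) (t : R) : R :=
  t - RInt (fun s => RInt (fun r => a r * w r) 0 s) 0 t.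

Lemma is_derive_volterra (a w : R -> R) t :
  (forall s, continuous a s) -> (forall s, continuous w s) ->
  is_derive (volterra a w) t (1 - RInt (fun r => a r * w r) 0 t).
Proof.
intros Ha Hw.
apply is_derive_Rminus; [exact (is_derive_id t)|].
apply (is_derive_RInt_cont (fun s => RInt (fun r => a r * w r) 0 s)).
intros s; eapply is_derive_continuous.
apply (is_derive_RInt_cont (fun r => a r * w r)); intros; continuity_R.
Qed.

(* The weight [exp (k t)] makes the operator a contraction on an interval of any length. *)
Lemma volterra_contraction (a w1 w2 : R -> R) T g B k :
  (forall s, continuous a s) -> (forall s, continuous w1 s) -> (forall s, continuous w2 s) ->
  (forall s, Rabs (a s) <= g) -> 0 < k -> 2 * g <= k ^ 2 ->
  (forall s, 0 <= s <= T -> Rabs (w1 s - w2 s) <= B * exp (k * s)) ->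
  forall t, 0 <= t <= T ->
    Rabs (volterra a w1 t - volterra a w2 t) <= B / 2 * exp (k * t).
Proof.
intros Ha H1 H2 Hg Hk Hgk HB t Ht.
assert (C1 : forall s, continuous (fun r => a r * w1 r) s) by (intros; continuity_R).
assert (C2 : forall s, continuous (fun r => a r * w2 r) s) by (intros; continuity_R).
assert (B0 : 0 <= B).
{ pose proof (HB 0 ltac:(lra)) as H; rewrite Rmult_0_r, exp_0 in H.
  pose proof (Rabs_pos (w1 0 - w2 0)); lra. }
assert (S1 : forall s, 0 <= s <= T ->
  Rabs (RInt (fun r => a r * w2 r) 0 s - RInt (fun r => a r * w1 r) 0 s)
    <= (g * B) / k * exp (k * s)).
{ apply (primitive_exp_bound _ (fun s => a s * w2 s - a s * w1 s)); [exact Hk| | |].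
  - rewrite !RInt_point; unfold zero; simpl; ring.
  - intros s; apply is_derive_Rminus;
      [apply (is_derive_RInt_cont (fun r => a r * w2 r)) |
       apply (is_derive_RInt_cont (fun r => a r * w1 r))]; assumption.
  - intros s Hs; replace (a s * w2 s - a s * w1 s) with (- (a s * (w1 s - w2 s))) by ring.
    rewrite Rabs_Ropp, Rabs_mult.
    replace (g * B * exp (k * s)) with (g * (B * exp (k * s))) by ring.
    apply Rmult_le_compat; auto using Rabs_pos. }
assert (S2 : Rabs (volterra a w1 t - volterra a w2 t) <= (g * B) / k / k * exp (k * t)).
{ apply (primitive_exp_bound (fun t => volterra a w1 t - volterra a w2 t)
    (fun s => RInt (fun r => a r * w2 r) 0 s - RInt (fun r => a r * w1 r) 0 s) T);
    [exact Hk| | | exact S1 | exact Ht].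
  - unfold volterra; rewrite !RInt_point; unfold zero; simpl; ring.
  - intros s; evar_last.
    + apply is_derive_Rminus; apply is_derive_volterra; assumption.
    + simpl; ring. }
eapply Rle_trans; [exact S2|].
apply Rmult_le_compat_r; [left; apply exp_pos|].
(* Since [g <= k ^ 2 / 2], the two divisions by [k] leave the factor 1/2. *)
apply Rle_trans with (k ^ 2 / 2 * B / k / k); [|right; field; lra].
unfold Rdiv; do 2 (apply Rmult_le_compat_r; [left; apply Rinv_0_lt_compat; lra|]); nra.
Qed.

(** The clamp makes every iterate constant on either side of [[0, T]], so that estimates on [[0, T]]
    hold on the whole line. *)
Fixpoint picard (T : R) (a : R -> R) (n : nat) : R -> R :=
  match n with
  | O => fun _ => 0
  | S n => fun t => volterra a (picard T a n) (clamp T t)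
  end.

Lemma continuous_volterra_clamp (a w : R -> R) T t : 0 < T ->
  (forall s, continuous a s) -> (forall s, continuous w s) ->
  continuous (fun t => volterra a w (clamp T t)) t.
Proof.
intros HT Ha Hw; apply (continuous_comp (clamp T) (volterra a w)).
- now apply continuous_clamp.
- eapply is_derive_continuous; now apply is_derive_volterra.
Qed.

Lemma ode_solution_exists (a : R -> R) T g : 0 < T ->
  (forall t, continuous a t) -> (forall t, Rabs (a t) <= g) ->
  exists z z' z'' : R -> R,
    (forall t, is_derive z t (z' t)) /\ (forall t, is_derive z' t (z'' t)) /\
    (forall t, continuous z'' t) /\ z 0 = 0 /\ z' 0 = 1 /\
    (forall t, 0 <= t <= T -> z'' t = - a t * z t).
Proof.
intros HT Ha Hg.
assert (g0 : 0 <= g) by (pose proof (Hg 0); pose proof (Rabs_pos (a 0)); lra).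
pose (k := 1 + g).
assert (Hk : 0 < k) by (unfold k; lra).
assert (Hgk : 2 * g <= k ^ 2) by (unfold k; nra).
assert (Pc : forall n t, continuous (picard T a n) t).
{ induction n; intros t; [apply continuous_const|].
  now apply continuous_volterra_clamp. }
(* The first difference is [clamp T t], at most [T]; each further one is halved by the
   contraction. *)
assert (HP : forall n t, Rabs (picard T a (S n) t - picard T a n t)
                         <= T / 2 ^ n * exp (k * clamp T t)).
{ induction n; intros t; pose proof (clamp_bounds T t HT) as Hc.
  - simpl; unfold volterra.
    rewrite (RInt_ext _ (fun _ => 0)).
    + rewrite RInt_const; unfold scal; simpl; unfold mult; simpl.
      rewrite Rabs_pos_eq by lra.
      assert (exp 0 <= exp (k * clamp T t)) by (apply exp_monotone; nra).
      rewrite exp_0 in *; nra.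
    + intros s _; rewrite (RInt_ext _ (fun _ => 0)) by (intros; simpl; ring).
      rewrite RInt_const; unfold scal; simpl; unfold mult; simpl; ring.
  - replace (T / 2 ^ S n) with (T / 2 ^ n / 2) by (simpl; field; apply pow_nonzero; lra).
    apply (volterra_contraction a (picard T a (S n)) (picard T a n) T g);
      try assumption; try apply Pc.
    intros s Hs; rewrite <- (clamp_id T s Hs) at 3; apply IHn. }
pose (w := fun t => real (Lim_seq (fun n => picard T a n t))).
assert (Hw : forall n t, Rabs (w t - picard T a n t) <= 2 * T / 2 ^ n * exp (k * clamp T t)).
{ intros n t; eapply Rle_trans.
  - apply (geometric_Lim_seq (fun n => picard T a n t) (T * exp (k * clamp T t))).
    intros m; eapply Rle_trans; [apply HP|]; right; field; apply pow_nonzero; lra.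
  - right; field; apply pow_nonzero; lra. }
(* This bounds the clamped weight on all of [R], which makes the convergence uniform and the limit
   continuous. *)
pose (K := exp (k * T)).
assert (HK : forall t, exp (k * clamp T t) <= K).
{ intros t; pose proof (clamp_bounds T t HT); apply exp_monotone; nra. }
assert (wc : forall t, continuous w t).
{ intros t; apply continuity_pt_filterlim.
  apply (CVU_continuity (picard T a) w t (mkposreal 1 Rlt_0_1)).
  - intros e He.
    assert (L : is_lim_seq (fun n => 2 * T * K / 2 ^ n) 0) by exact (is_lim_seq_div_pow2 _).
    apply is_lim_seq_spec in L; destruct (L (mkposreal e He)) as [N HN].
    exists N; intros n y Hn _; specialize (HN n Hn); simpl in HN.
    apply Rabs_def2 in HN.
    eapply Rle_lt_trans; [apply Hw|].
    apply Rle_lt_trans with (2 * T / 2 ^ n * K);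
      [|replace (2 * T / 2 ^ n * K) with (2 * T * K / 2 ^ n)
          by (field; apply pow_nonzero; lra); lra].
    apply Rmult_le_compat_l; [|apply HK].
    apply Rdiv_le_0_compat; [lra | apply pow_lt; lra].
  - intros n y _; apply continuity_pt_filterlim, Pc.
  - unfold Boule; rewrite Rminus_diag, Rabs_R0; exact Rlt_0_1. }
(* Both sides lie within a multiple of [/ 2 ^ n] of [picard T a (S n) t], for every [n]. *)
assert (fix_w : forall t, 0 <= t <= T -> w t = volterra a w t).
{ intros t Ht; apply Rminus_diag_uniq.
  apply (geometric_bound_eq_0 _ (2 * T * exp (k * t))); intros n.
  assert (V : Rabs (volterra a w t - volterra a (picard T a n) t)
              <= 2 * T / 2 ^ n / 2 * exp (k * t)).
  { apply (volterra_contraction a w (picard T a n) T g); try assumption; try apply Pc.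
    intros s Hs; rewrite <- (clamp_id T s Hs) at 3; apply Hw. }
  pose proof (Hw (S n) t) as W; simpl picard in W; rewrite (clamp_id T t Ht) in W.
  replace (w t - volterra a w t) with
    ((w t - volterra a (picard T a n) t) - (volterra a w t - volterra a (picard T a n) t))
    by ring.
  eapply Rle_trans; [apply Rabs_triang|]; rewrite Rabs_Ropp.
  replace (2 * T * exp (k * t) / 2 ^ n) with
    (2 * T / 2 ^ S n * exp (k * t) + 2 * T / 2 ^ n / 2 * exp (k * t))
    by (simpl; field; apply pow_nonzero; lra).
  lra. }
assert (Cw : forall t, continuous (fun r => a r * w r) t) by (intros; continuity_R).
(* The witness is [volterra a w] rather than [w]: it is twice differentiable on all of [R], whereas
   [w] is clamped. The two agree on [[0, T]], which gives the equation there. *)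
exists (volterra a w), (fun t => 1 - RInt (fun r => a r * w r) 0 t), (fun t => - (a t * w t)).
split; [|split; [|split; [|split; [|split]]]].
- intros t; now apply is_derive_volterra.
- intros t; evar_last.
  + apply is_derive_Rminus; [exact (is_derive_const 1 t)|].
    now apply (is_derive_RInt_cont (fun r => a r * w r)).
  + unfold zero; simpl; ring.
- intros; continuity_R.
- unfold volterra; rewrite RInt_point; unfold zero; simpl; ring.
- rewrite RInt_point; unfold zero; simpl; ring.
- intros t Ht; rewrite <- fix_w by exact Ht; ring.
Qed.

(** * Negativity of the quadratic form under zero boundary values *)

Lemma RInt_Rplus (f g : R -> R) a b :
  (forall t, continuous f t) -> (forall t, continuous g t) ->
  RInt (fun t => f t + g t) a b = RInt f a b + RInt g a b.
Proof. intros Hf Hg; apply (RInt_plus f g); now apply ex_RInt_cont. Qed.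

Lemma RInt_Rminus (f g : R -> R) a b :
  (forall t, continuous f t) -> (forall t, continuous g t) ->
  RInt (fun t => f t - g t) a b = RInt f a b - RInt g a b.
Proof. intros Hf Hg; apply (RInt_minus f g); now apply ex_RInt_cont. Qed.

Lemma RInt_Rscal (f : R -> R) c a b : (forall t, continuous f t) ->
  RInt (fun t => c * f t) a b = c * RInt f a b.
Proof. intros Hf; apply (RInt_scal f); now apply ex_RInt_cont. Qed.

(* For [sqrt g < k < PI / b], Wirtinger bounds the form by [(g - k ^ 2) * RInt (h ^ 2)]. *)
Lemma dirichlet_form_negative (a h h' : R -> R) g b :
  0 < b -> 0 <= g -> sqrt g * b < PI ->
  (forall t, continuous a t) -> (forall t, a t <= g) ->
  (forall t, is_derive h t (h' t)) -> (forall t, continuous h' t) ->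
  h 0 = 0 -> h b = 0 ->
  RInt (fun t => a t * h t ^ 2 - h' t ^ 2) 0 b <= 0 /\
  (0 <= RInt (fun t => a t * h t ^ 2 - h' t ^ 2) 0 b ->
   forall t, 0 <= t <= b -> h t = 0).
Proof.
intros Hb Hg Hgb Ca Hag Hh Ch h0 hb.
pose (k := (sqrt g + PI / b) / 2).
pose proof (sqrt_pos g) as Sg; pose proof (sqrt_sqrt g Hg) as SS.
assert (Hlt : sqrt g < PI / b).
{ apply (Rmult_lt_reg_r b); [exact Hb|]; field_simplify (PI / b * b); lra. }
assert (Hk : 0 < k) by (unfold k; lra).
assert (Hgk : g < k ^ 2).
{ assert (sqrt g < k) by (unfold k; lra); nra. }
assert (Hkb : k * b < PI).
{ replace PI with (PI / b * b) by (field; lra).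
  apply Rmult_lt_compat_r; unfold k; lra. }
pose proof (wirtinger h h' b k Hb Hk Hkb Hh Ch h0 hb) as W.
assert (C0 : forall t, continuous h t) by (intros; continuity_R).
assert (C1 : forall t, continuous (fun t : R => h t ^ 2) t) by (intros; continuity_R).
assert (C2 : forall t, continuous (fun t : R => h' t ^ 2) t) by (intros; continuity_R).
assert (C3 : forall t, continuous (fun t : R => a t * h t ^ 2) t) by (intros; continuity_R).
rewrite (RInt_Rminus _ _ 0 b C3 C2).
assert (L : RInt (fun t => a t * h t ^ 2) 0 b <= g * RInt (fun t => h t ^ 2) 0 b).
{ rewrite <- RInt_Rscal by exact C1.
  apply RInt_le; [lra | now apply ex_RInt_cont | apply ex_RInt_cont; intros; continuity_R |].
  intros t _; apply Rmult_le_compat_r; [apply pow2_ge_0 | apply Hag]. }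
assert (P : 0 <= RInt (fun t => h t ^ 2) 0 b).
{ apply RInt_ge_0; [lra | now apply ex_RInt_cont | intros; apply pow2_ge_0]. }
(* As [g - k ^ 2 < 0], a nonnegative form forces the integral of [h ^ 2] to be nonpositive. *)
split; [nra|intros H].
apply RInt_sqr_nonpos_eq_0; try assumption; nra.
Qed.

(** * Positivity and the boundary value problem *)

(** At a zero [t] of [z] the quadratic form of [z] on [[0, t]] would be 0, so [z] would vanish on
    [[0, t]], against its slope 1 at 0. Without zeros, [z] keeps the sign that it has near 0. *)
Lemma ode_solution_pos (a z z' z'' : R -> R) T g :
  0 <= g -> sqrt g * T < PI ->
  (forall t, continuous a t) -> (forall t, a t <= g) ->
  (forall t, is_derive z t (z' t)) -> (forall t, is_derive z' t (z'' t)) ->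
  (forall t, continuous z'' t) -> z 0 = 0 -> z' 0 = 1 ->
  (forall t, 0 <= t <= T -> z'' t = - a t * z t) ->
  forall t, 0 < t <= T -> 0 < z t.
Proof.
intros Hg HgT Ca Hag Hz Hz' Cz z0 z'0 ode.
assert (near : exists d, 0 < d /\ forall t, 0 < t < d -> 0 < z t).
{ destruct (proj1 (is_derive_Reals _ _ _) (Hz 0) (1 / 2) ltac:(lra)) as [d Hd].
  exists d; split; [apply cond_pos|]; intros t Ht.
  specialize (Hd t ltac:(lra) ltac:(rewrite Rabs_pos_eq; lra)).
  rewrite Rplus_0_l, z0, z'0, Rminus_0_r in Hd; apply Rabs_def2 in Hd.
  replace (z t) with (z t / t * t) by (field; lra); nra. }
destruct near as [d [d0 near]].
assert (nz : forall t, 0 < t <= T -> z t <> 0).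
{ intros t Ht E.
  assert (C1 : forall s, continuous (fun s : R => z' s * z s) s) by (intros; continuity_R).
  assert (z_eq_0 : forall s, 0 <= s <= t -> z s = 0).
  { apply (dirichlet_form_negative a z z' g t); try assumption; try lra.
    - pose proof (sqrt_pos g); nra.
    - intros; continuity_R.
    (* By the equation the integrand is [- (z' z)'], and [z' z] vanishes at 0 and at [t]. *)
    - rewrite (RInt_ext _ (fun s => -1 * (z'' s * z s + z' s * z' s))).
      + rewrite RInt_Rscal by (intros; continuity_R).
        rewrite (RInt_antiderivative (fun s => z' s * z s)).
        * rewrite E, z0; lra.
        * intros; now apply is_derive_Rmult.
        * intros; continuity_R.
      + rewrite Rmin_left, Rmax_right by lra; intros s Hs; rewrite ode by lra; simpl; ring. }
  pose proof (Rmin_l (d / 2) (t / 2)); pose proof (Rmin_r (d / 2) (t / 2)).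
  assert (0 < Rmin (d / 2) (t / 2)) by (apply Rmin_glb_lt; lra).
  pose proof (near (Rmin (d / 2) (t / 2)) ltac:(lra)).
  rewrite z_eq_0 in *; lra. }
intros t Ht; destruct (Rlt_le_dec 0 (z t)) as [H|H]; [exact H|exfalso].
pose (s := Rmin (d / 2) (t / 2)).
pose proof (Rmin_l (d / 2) (t / 2)); pose proof (Rmin_r (d / 2) (t / 2)); fold s in H0, H1.
assert (s0 : 0 < s) by (apply Rmin_glb_lt; lra).
pose proof (near s ltac:(lra)) as zs.
destruct (IVT_gen z s t 0) as [x [Hx zx]].
- intros x; apply continuous_continuity_pt; continuity_R.
- rewrite Rmin_right, Rmax_left; lra.
- rewrite Rmin_left, Rmax_right in Hx by lra.
  apply (nz x); lra.
Qed.

(** Time is reversed: [y] solves the initial value problem for [a (T - t)], and [y (T - t) / y T]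
    has the required boundary values because [y T > 0]. *)
Lemma boundary_value_solution (a : R -> R) T g : 0 < T -> sqrt g * T < PI ->
  (forall t, continuous a t) -> (forall t, 0 <= a t <= g) ->
  exists z z' z'' : R -> R,
    (forall t, is_derive z t (z' t)) /\ (forall t, is_derive z' t (z'' t)) /\
    (forall t, continuous z'' t) /\ z 0 = 1 /\ z T = 0 /\
    (forall t, 0 <= t <= T -> z'' t = - a t * z t) /\
    (forall t, 0 <= t <= T -> 0 <= z t).
Proof.
intros HT HgT Ca Ha.
assert (Hg : 0 <= g) by (pose proof (Ha 0); lra).
pose (ar := fun t => a (T - t)).
assert (Car : forall t, continuous ar t).
{ intros t; apply (continuous_comp (fun t => T - t) a); [continuity_R | apply Ca]. }
destruct (ode_solution_exists ar T g) as [y [y' [y'' [Hy [Hy' [Cy [y0 [y'0 ode]]]]]]]].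
- exact HT.
- exact Car.
- intros t; unfold ar; rewrite Rabs_pos_eq; apply Ha.
- assert (pos : forall t, 0 < t <= T -> 0 < y t).
  { apply (ode_solution_pos ar y y' y'' T g); try assumption; intros; apply Ha. }
  assert (yT : 0 < y T) by (apply pos; lra).
  assert (rev : forall f f' : R -> R, (forall t, is_derive f t (f' t)) ->
    forall t, is_derive (fun t => f (T - t)) t (- f' (T - t))).
  { intros f f' Hf t; replace (- f' (T - t)) with ((0 - 1) * f' (T - t)) by ring.
    apply (is_derive_comp f (fun t => T - t)); [apply Hf|].
    apply is_derive_Rminus; [exact (is_derive_const T t) | exact (is_derive_id t)]. }
  exists (fun t => / y T * y (T - t)), (fun t => / y T * - y' (T - t)),
    (fun t => / y T * y'' (T - t)).
  split; [|split; [|split; [|split; [|split; [|split]]]]].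
  + intros t; apply is_derive_Rscal; now apply rev.
  + intros t; apply is_derive_Rscal.
    replace (y'' (T - t)) with (- - y'' (T - t)) by ring.
    apply (rev (fun t => - y' t) (fun t => - y'' t)).
    intros s; exact (is_derive_opp y' s _ (Hy' s)).
  + intros t; apply continuous_Rmult; [apply continuous_const|].
    apply (continuous_comp (fun t => T - t) y''); [continuity_R | apply Cy].
  + rewrite Rminus_0_r; field; lra.
  + rewrite Rminus_diag, y0; ring.
  + intros t Ht; rewrite ode by lra; unfold ar.
    replace (T - (T - t)) with t by ring; ring.
  + intros t Ht; apply Rmult_le_pos; [left; now apply Rinv_0_lt_compat|].
    destruct (Req_dec t T) as [->|]; [rewrite Rminus_diag, y0; lra|].
    left; apply pos; lra.
Qed.

(** * Concavity from a nonincreasing derivative *)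

Lemma concave_on_of_derive (f f' : R -> R) T :
  (forall t, is_derive f t (f' t)) ->
  (forall s t, 0 <= s -> s <= t -> t <= T -> f' t <= f' s) ->
  concave_on (Icc 0 T) f.
Proof.
intros Hf Hd.
assert (key : forall x y l, Icc 0 T x -> Icc 0 T y -> x <= y -> 0 <= l <= 1 ->
  l * f x + (1 - l) * f y <= f (l * x + (1 - l) * y)).
{ intros x y l [Hx0 HxT] [Hy0 HyT] Hxy Hl; set (m := l * x + (1 - l) * y).
  assert (Hm : x <= m <= y) by (unfold m; nra).
  destruct (MVT_gen f x m f') as [c [Hc Ec]];
    [intros; apply Hf | intros; apply continuous_continuity_pt; continuity_R |].
  destruct (MVT_gen f m y f') as [e [He Ee]];
    [intros; apply Hf | intros; apply continuous_continuity_pt; continuity_R |].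
  rewrite Rmin_left, Rmax_right in Hc, He by lra.
  assert (D : f' e <= f' c) by (apply Hd; lra).
  replace (m - x) with ((1 - l) * (y - x)) in Ec by (unfold m; ring).
  replace (y - m) with (l * (y - x)) in Ee by (unfold m; ring).
  (* By the two mean value identities this product equals [f m - (l * f x + (1 - l) * f y)]. *)
  assert (0 <= l * (1 - l) * (y - x) * (f' c - f' e)).
  { repeat apply Rmult_le_pos; lra. }
  nra. }
intros x y l Hx Hy Hl; destruct (Rle_dec x y) as [H|H]; [now apply key|].
replace (l * f x + (1 - l) * f y) with ((1 - l) * f y + (1 - (1 - l)) * f x) by ring.
replace (l * x + (1 - l) * y) with ((1 - l) * y + (1 - (1 - l)) * x) by ring.
apply key; try assumption; lra.
Qed.

(** * Passing between derivatives within [[0, T]] and derivatives on [R] *)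

Lemma continuous_comp_clamp (f : R -> R) T : 0 < T ->
  (forall t, Icc 0 T t -> continue_in f (Icc 0 T) t) ->
  forall t, continuous (fun t : R => f (clamp T t)) t.
Proof.
intros HT Hf t; apply filterlim_locally; intros e.
destruct (Hf (clamp T t) (clamp_bounds T t HT) e (cond_pos e)) as [d [Hd H]].
exists (mkposreal d Hd); intros y Hy; change (Rabs (y - t) < d) in Hy.
change (Rabs (f (clamp T y) - f (clamp T t)) < e).
(* [continue_in] speaks only of points other than the centre, so coinciding clamped points are
   treated apart. *)
destruct (Req_dec (clamp T t) (clamp T y)) as [E|N].
- rewrite E, Rminus_diag, Rabs_R0; apply cond_pos.
- apply H; split; [split; [exact (clamp_bounds T y HT) | exact N]|].
  pose proof (clamp_lipschitz T y t HT); simpl; unfold Rdist; lra.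
Qed.

(** The extension is [f 0] plus the integral of the clamped derivative. It agrees with [f] at 0 and
    has the same derivative inside [(0, T)], so the mean value theorem identifies the two on
    [[0, T]]. *)
Lemma C1_on_extension (f : R -> R) T : 0 < T -> C1_on (Icc 0 T) f ->
  exists F : R -> R,
    (forall t, is_derive F t (Derive_in (Icc 0 T) f (clamp T t))) /\
    (forall t, continuous (fun t : R => Derive_in (Icc 0 T) f (clamp T t)) t) /\
    (forall t, Icc 0 T t -> F t = f t).
Proof.
intros HT HC; set (v := fun t => Derive_in (Icc 0 T) f (clamp T t)).
assert (Cv : forall t, continuous v t).
{ apply continuous_comp_clamp; [exact HT | intros t Ht; apply (HC t Ht)]. }
assert (Cf : forall t, continuous (fun t : R => f (clamp T t)) t).
{ apply continuous_comp_clamp; [exact HT | intros t Ht].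
  eapply cont_deriv; apply (HC t Ht). }
pose (F := fun t => f 0 + RInt v 0 t).
assert (HF : forall t, is_derive F t (v t)).
{ intros t; replace (v t) with (0 + v t) by ring.
  apply is_derive_Rplus; [exact (is_derive_const (f 0) t) | now apply is_derive_RInt_cont]. }
exists F; split; [exact HF | split; [exact Cv | intros t Ht]].
destruct (MVT_gen (fun s => f (clamp T s) - F s) 0 t (fun _ => 0)) as [c [_ E]].
- rewrite Rmin_left, Rmax_right by apply Ht; intros s Hs.
  assert (Hs' : Icc 0 T s) by (unfold Icc in *; lra).
  replace 0 with (v s - v s) by ring; apply is_derive_Rminus; [|apply HF].
  apply is_derive_Reals; intros e He.
  destruct (proj1 (HC s Hs') e He) as [d [Hd H]].
  (* This radius keeps [s + x] inside [[0, T]], where the clamp is the identity. *)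
  assert (Hm : 0 < Rmin d (Rmin s (T - s))).
  { repeat apply Rmin_glb_lt; unfold Icc in *; lra. }
  exists (mkposreal _ Hm); intros x x0 Hx; simpl in Hx.
  pose proof (Rmin_l d (Rmin s (T - s))); pose proof (Rmin_r d (Rmin s (T - s))).
  pose proof (Rmin_l s (T - s)); pose proof (Rmin_r s (T - s)).
  assert (Hb : 0 <= s + x <= T) by (apply Rabs_def2 in Hx; lra).
  unfold v; rewrite !clamp_id by assumption.
  specialize (H (s + x)); simpl in H; unfold Rdist in H.
  replace (s + x - s) with x in H by ring.
  apply H; repeat split; try apply Hb; lra.
- intros s _; apply continuous_continuity_pt; continuity_R.
- unfold F in E at 2; rewrite RInt_point in E; change (@zero R_CompleteNormedModule) with 0 in E.
  rewrite !clamp_id in E by (unfold Icc in *; lra); lra.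
Qed.

Lemma D_in_of_derive (D : R -> Prop) (f F : R -> R) t l :
  D t -> (forall s, D s -> f s = F s) -> is_derive F t l -> D_in f (fun _ => l) D t.
Proof.
intros Dt E H; apply is_derive_Reals in H; intros e He.
destruct (H e He) as [d Hd]; exists d; split; [apply cond_pos|].
intros s [[Ds N] Hs]; simpl in *; unfold Rdist in *.
rewrite !E by assumption.
specialize (Hd (s - t) ltac:(lra) Hs).
now replace (t + (s - t)) with s in Hd by ring.
Qed.

(** Makes limits within [[0, T]] unique, so that the [iota] in [Derive_in] designates the actual
    derivative. *)
Lemma adherent_Icc T t : 0 < T -> Icc 0 T t -> adhDa (D_x (Icc 0 T) t) t.
Proof.
intros HT Ht e He; unfold Icc, D_x in *.
pose proof (Rmin_l (e / 2) (T / 2)); pose proof (Rmin_r (e / 2) (T / 2)).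
assert (0 < Rmin (e / 2) (T / 2)) by (apply Rmin_glb_lt; lra).
destruct (Rle_dec t (T / 2)).
- exists (t + Rmin (e / 2) (T / 2)); unfold Rdist; repeat split; try lra.
  rewrite Rabs_pos_eq; lra.
- exists (t - Rmin (e / 2) (T / 2)); unfold Rdist; repeat split; try lra.
  rewrite Rabs_left; lra.
Qed.

Lemma Derive_in_of_derive (f F : R -> R) T t l : 0 < T ->
  (forall s, Icc 0 T s -> f s = F s) -> is_derive F t l -> Icc 0 T t ->
  Derive_in (Icc 0 T) f t = l.
Proof.
intros HT E H Ht; apply (iota_unique (V := R_CompleteNormedModule)).
- intros y Hy; eapply (single_limit _ _ _ _ t (adherent_Icc T t HT Ht)); [exact Hy|].
  exact (D_in_of_derive _ f F t l Ht E H).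
- exact (D_in_of_derive _ f F t l Ht E H).
Qed.

Lemma C1_on_of_derive (f F F' : R -> R) T : 0 < T ->
  (forall s, Icc 0 T s -> f s = F s) ->
  (forall t, is_derive F t (F' t)) -> (forall t, continuous F' t) ->
  C1_on (Icc 0 T) f.
Proof.
intros HT E H C t Ht.
assert (E' : forall s, Icc 0 T s -> Derive_in (Icc 0 T) f s = F' s).
{ intros s Hs; now apply (Derive_in_of_derive f F T). }
split.
- unfold D_in; rewrite (E' t Ht); exact (D_in_of_derive _ f F t _ Ht E (H t)).
- intros e He.
  destruct (proj1 (filterlim_locally F' (F' t)) (C t) (mkposreal e He)) as [d Hd].
  exists d; split; [apply cond_pos|]; intros s [[Hs _] Hd'].
  rewrite !E' by assumption; exact (Hd s Hd').
Qed.

(** * The objective [J] and its maximizer *)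

(** The boundary term of [theta * xi ^ 2 / 2] is the same for all of [Xi T Q], so only the quadratic
    form distinguishes strategies. *)
Lemma J_integrated_by_parts (T Q eta : R) (theta xi X : R -> R) :
  0 < T -> 0 < eta -> C1_on (Icc 0 T) theta -> Xi T Q xi ->
  (forall t, is_derive X t (velocity T xi (clamp T t))) ->
  (forall t, continuous (fun t : R => velocity T xi (clamp T t)) t) ->
  (forall t, Icc 0 T t -> X t = xi t) ->
  J T eta theta xi = - theta 0 * Q ^ 2 / 2 +
    eta * RInt (fun t => - Derive_in (Icc 0 T) theta (clamp T t) / (2 * eta) * X t ^ 2
                         - velocity T xi (clamp T t) ^ 2) 0 T.
Proof.
intros HT Heta Htheta [_ [x0 xT]] HX Cv EX.
destruct (C1_on_extension theta T HT Htheta) as [Th [HTh [CTh ETh]]].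
set (v := fun t => velocity T xi (clamp T t)) in *.
set (th := fun t => Derive_in (Icc 0 T) theta (clamp T t)) in *.
unfold J.
rewrite (RInt_ext _ (fun t =>
  (/ 2 * (th t * X t ^ 2 + Th t * (2 * X t * v t)))
   + eta * (- th t / (2 * eta) * X t ^ 2 - v t ^ 2))).
- rewrite RInt_Rplus, (RInt_Rscal _ eta) by (intros; continuity_R).
  rewrite (RInt_antiderivative (fun t => / 2 * (Th t * X t ^ 2))).
  + rewrite !EX, !ETh, x0, xT by (unfold Icc; lra).
    apply Rplus_eq_compat_r; field.
  + intros t; apply is_derive_Rscal, is_derive_Rmult; [apply HTh | now apply is_derive_Rsqr].
  + intros; continuity_R.
- rewrite Rmin_left, Rmax_right by lra; intros t Ht.
  rewrite <- EX, <- ETh by (unfold Icc; lra).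
  replace (velocity T xi t) with (v t) by (unfold v; rewrite clamp_id; lra).
  simpl; field; lra.
Qed.

Lemma decreasing_on_Derive_in_nonpos (f : R -> R) T t : 0 < T ->
  C1_on (Icc 0 T) f -> decreasing_on (Icc 0 T) f -> Icc 0 T t ->
  Derive_in (Icc 0 T) f t <= 0.
Proof.
intros HT HC Hd Ht; destruct (Rle_lt_dec (Derive_in (Icc 0 T) f t) 0) as [H|H]; [exact H|].
(* The tolerance is the positive derivative itself, which keeps nearby difference quotients
   positive. *)
exfalso; destruct (proj1 (HC t Ht) _ H) as [e [He Hl]].
destruct (adherent_Icc T t HT Ht e He) as [s [[Hs N] Hse]].
specialize (Hl s (conj (conj Hs N) Hse)); simpl in Hl; unfold Rdist in Hl.
apply Rabs_def2 in Hl.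
assert (Hq : 0 < (f s - f t) / (s - t)) by lra.
assert (E : f s - f t = (f s - f t) / (s - t) * (s - t)) by (field; lra).
destruct (Rle_lt_dec s t).
- pose proof (Hd s t Hs Ht ltac:(lra)); nra.
- pose proof (Hd t s Ht Hs ltac:(lra)); nra.
Qed.

Lemma Xi_scaled (z z' z'' : R -> R) T Q : 0 < T ->
  (forall t, is_derive z t (z' t)) -> (forall t, is_derive z' t (z'' t)) ->
  (forall t, continuous z'' t) -> z 0 = 1 -> z T = 0 ->
  Xi T Q (fun t => Q * z t) /\
  (forall t, Icc 0 T t -> velocity T (fun t => Q * z t) t = Q * z' t).
Proof.
intros HT Hz Hz' Cz z0 zT.
assert (V : forall t, Icc 0 T t -> velocity T (fun t => Q * z t) t = Q * z' t).
{ intros t Ht; apply (Derive_in_of_derive _ (fun t => Q * z t)); try assumption; try easy.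
  now apply is_derive_Rscal. }
split; [split; [split|split]|exact V].
- apply (C1_on_of_derive _ (fun t => Q * z t) (fun t => Q * z' t)); try easy.
  + intros; now apply is_derive_Rscal.
  + intros; continuity_R.
- apply (C1_on_of_derive _ (fun t => Q * z' t) (fun t => Q * z'' t)); try easy.
  + intros; now apply is_derive_Rscal.
  + intros; continuity_R.
- rewrite z0; ring.
- rewrite zT; ring.
Qed.

(** Writing [xi = Q * z + h] with [h] zero at both ends, the equation for [z] kills the cross term.
    The two values of [J] then differ by [eta] times the form at [h], which is nonpositive and
    vanishes only for [h = 0]. *)
Lemma euler_lagrange_optimal (T eta g : R) (theta z z' z'' : R -> R) :
  let a := fun t => - Derive_in (Icc 0 T) theta (clamp T t) / (2 * eta) in
  0 < T -> 0 < eta -> C1_on (Icc 0 T) theta ->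
  0 <= g -> sqrt g * T < PI -> (forall t, a t <= g) ->
  (forall t, is_derive z t (z' t)) -> (forall t, is_derive z' t (z'' t)) ->
  (forall t, continuous z'' t) -> z 0 = 1 -> z T = 0 ->
  (forall t, 0 <= t <= T -> z'' t = - a t * z t) ->
  forall Q xi, Xi T Q xi ->
    J T eta theta xi <= J T eta theta (fun t => Q * z t) /\
    (J T eta theta (fun t => Q * z t) <= J T eta theta xi ->
     forall t, Icc 0 T t -> xi t = Q * z t).
Proof.
intros a HT Heta Htheta Hg HgT Ha Hz Hz' Cz z0 zT ode Q xi Hxi.
destruct (Xi_scaled z z' z'' T Q HT Hz Hz' Cz z0 zT) as [HZ VZ].
assert (Ca : forall t, continuous a t).
{ intros t; unfold a; apply continuous_Rdiv_const, continuous_Ropp.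
  apply (continuous_comp_clamp (Derive_in (Icc 0 T) theta)); [exact HT|].
  intros s Hs; apply (Htheta s Hs). }
destruct (C1_on_extension xi T HT (proj1 (proj1 Hxi))) as [X [HX [CX EX]]].
destruct (C1_on_extension _ T HT (proj1 (proj1 HZ))) as [Z [HZ' [CZ EZ]]].
rewrite (J_integrated_by_parts T Q eta theta xi X) by assumption.
rewrite (J_integrated_by_parts T Q eta theta _ Z) by assumption.
set (u := fun t => velocity T xi (clamp T t)) in *.
set (v := fun t => velocity T (fun t => Q * z t) (clamp T t)) in *.
change (fun t => - Derive_in (Icc 0 T) theta (clamp T t) / (2 * eta) * X t ^ 2
  - velocity T xi (clamp T t) ^ 2) with (fun t => a t * X t ^ 2 - u t ^ 2).
change (fun t => - Derive_in (Icc 0 T) theta (clamp T t) / (2 * eta) * Z t ^ 2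
  - velocity T (fun t => Q * z t) (clamp T t) ^ 2) with (fun t => a t * Z t ^ 2 - v t ^ 2).
pose (h := fun t => X t - Z t); pose (h' := fun t => u t - v t).
assert (Hh : forall t, is_derive h t (h' t)).
{ intros t; now apply is_derive_Rminus. }
assert (Ch : forall t, continuous h' t) by (intros; unfold h'; continuity_R).
assert (h0 : h 0 = 0).
{ unfold h; rewrite EX, EZ by (unfold Icc; lra).
  rewrite z0, (proj1 (proj2 Hxi)); ring. }
assert (hT : h T = 0).
{ unfold h; rewrite EX, EZ by (unfold Icc; lra).
  rewrite zT, (proj2 (proj2 Hxi)); ring. }
destruct (dirichlet_form_negative a h h' g T HT Hg HgT Ca Ha Hh Ch h0 hT) as [N N0].
assert (E : RInt (fun t => a t * X t ^ 2 - u t ^ 2) 0 T =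
  RInt (fun t => a t * Z t ^ 2 - v t ^ 2) 0 T + RInt (fun t => a t * h t ^ 2 - h' t ^ 2) 0 T).
(* The cross term [2 * Q * (a z h - z' h')] becomes [-2 * Q * (z' h)'] through [z'' = - a z]. *)
{ rewrite (RInt_ext _ (fun t => ((a t * Z t ^ 2 - v t ^ 2) + (a t * h t ^ 2 - h' t ^ 2))
    + -2 * Q * (z'' t * h t + z' t * h' t))).
  - rewrite RInt_Rplus, RInt_Rplus, RInt_Rscal by (intros; continuity_R).
    rewrite (RInt_antiderivative (fun t => z' t * h t) (fun t => z'' t * h t + z' t * h' t)).
    + rewrite h0, hT; simpl; ring.
    + intros; now apply is_derive_Rmult.
    + intros; continuity_R.
  - rewrite Rmin_left, Rmax_right by lra; intros t Ht.
    assert (EZt : Z t = Q * z t) by (apply EZ; unfold Icc; lra).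
    assert (Evt : v t = Q * z' t).
    { unfold v; rewrite clamp_id by lra; apply VZ; unfold Icc; lra. }
    rewrite ode by lra; unfold h, h'; rewrite EZt, Evt; simpl; ring. }
rewrite E; set (I := RInt (fun t => a t * h t ^ 2 - h' t ^ 2) 0 T) in *.
split; [nra|intros Hle t Ht].
assert (Hh0 : h t = 0) by (apply N0; [nra | exact Ht]).
unfold h in Hh0; rewrite EX, EZ in Hh0 by exact Ht; lra.
Qed.

(** * Sign changes and properties of the optimal strategy *)

(** Of two consecutive sign changes, one goes from negative to positive. *)
Lemma nonincreasing_sign_changes (D : R -> Prop) (f : R -> R) :
  decreasing_on D f -> ~ at_least_sign_changes D f 2.
Proof.
intros Hf [t [HD Ht]].
destruct (Ht 0%nat ltac:(lia)) as [L0 S0]; destruct (Ht 1%nat ltac:(lia)) as [L1 S1].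
pose proof (Hf _ _ (HD 0%nat ltac:(lia)) (HD 1%nat ltac:(lia)) ltac:(lra)).
pose proof (Hf _ _ (HD 1%nat ltac:(lia)) (HD 2%nat ltac:(lia)) ltac:(lra)).
destruct (Rlt_le_dec (f (t 1%nat)) 0); nra.
Qed.

Theorem proposition14
  (T Q eta : R) (theta : R -> R) (thetabar gamma : R)
  (hT : 0 < T) (hQ : 0 < Q) (heta : 0 < eta)
  (htheta_pos : forall t, Icc 0 T t -> 0 < theta t)
  (htheta_C1 : C1_on (Icc 0 T) theta)
  (htheta_decr : decreasing_on (Icc 0 T) theta)
  (hthetabar : is_max_on (Icc 0 T)
     (fun t => Rmax (- Derive_in (Icc 0 T) theta t) 0) thetabar)
  (hgamma : gamma = thetabar / (2 * eta))
  (hsmall : sqrt gamma * T < PI) :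
  exists zeta : R -> R,
    optimal T eta theta Q zeta /\
    (forall xi, optimal T eta theta Q xi ->
       forall t, Icc 0 T t -> xi t = zeta t) /\
    (forall t, Icc 0 T t -> 0 <= zeta t) /\
    (monotonic T zeta \/
     changes_sign_exactly_once (Icc 0 T) (velocity T zeta)) /\
    (monotonic T zeta -> ~ price_manipulation T eta theta) /\
    concave_on (Icc 0 T) zeta /\
    (forall t, Icc 0 T t -> TWAP T Q t <= zeta t).
Proof.
pose (a := fun t => - Derive_in (Icc 0 T) theta (clamp T t) / (2 * eta)).
assert (Ha : forall t, 0 <= a t <= gamma).
{ intros t; pose proof (clamp_bounds T t hT) as Hc.
  pose proof (decreasing_on_Derive_in_nonpos theta T _ hT htheta_C1 htheta_decr Hc).
  pose proof (proj2 hthetabar _ Hc) as Hm; simpl in Hm.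
  pose proof (Rmax_l (- Derive_in (Icc 0 T) theta (clamp T t)) 0).
  rewrite hgamma; unfold a; split.
  - apply Rdiv_le_0_compat; lra.
  - apply Rmult_le_compat_r; [left; apply Rinv_0_lt_compat|]; lra. }
assert (gamma_pos : 0 <= gamma) by (pose proof (Ha 0); lra).
assert (Ca : forall t, continuous a t).
{ intros t; unfold a; apply continuous_Rdiv_const, continuous_Ropp.
  apply (continuous_comp_clamp (Derive_in (Icc 0 T) theta)); [exact hT|].
  intros s Hs; apply (htheta_C1 s Hs). }
destruct (boundary_value_solution a T gamma hT hsmall Ca Ha)
  as [z [z' [z'' [Hz [Hz' [Cz [z0 [zT [ode zpos]]]]]]]]].
assert (z'_decr : forall s t, 0 <= s -> s <= t -> t <= T -> z' t <= z' s).
{ intros s t Hs Hst HtT.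
  cut (- z' s <= - z' t); [lra|].
  apply (nondecreasing_of_derive (fun t => - z' t) (fun t => - z'' t)); [exact Hst| |].
  - intros r _; exact (is_derive_opp z' r _ (Hz' r)).
  - intros r Hr; rewrite ode by lra.
    pose proof (Ha r); pose proof (zpos r ltac:(lra)); nra. }
assert (opt : forall Q xi, Xi T Q xi ->
    J T eta theta xi <= J T eta theta (fun t => Q * z t) /\
    (J T eta theta (fun t => Q * z t) <= J T eta theta xi ->
     forall t, Icc 0 T t -> xi t = Q * z t)).
{ apply (euler_lagrange_optimal T eta gamma theta z z' z''); try assumption.
  intros; apply Ha. }
destruct (Xi_scaled z z' z'' T Q hT Hz Hz' Cz z0 zT) as [HZ VZ].
assert (Hconc : concave_on (Icc 0 T) (fun t => Q * z t)).
{ apply (concave_on_of_derive _ (fun t => Q * z' t)).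
  - intros; now apply is_derive_Rscal.
  - intros; apply Rmult_le_compat_l; [lra|auto]. }
exists (fun t => Q * z t).
split; [|split; [|split; [|split; [|split; [|split]]]]].
- split; [exact HZ|intros xi Hxi; apply (opt Q xi Hxi)].
- intros xi [Hxi Hmax]; apply (opt Q xi Hxi), Hmax, HZ.
- intros t Ht; apply Rmult_le_pos; [lra | now apply zpos].
- assert (Hv : decreasing_on (Icc 0 T) (velocity T (fun t => Q * z t))).
  { intros s t Hs Ht Hst; rewrite !VZ by assumption.
    apply Rmult_le_compat_l; [lra | apply z'_decr; unfold Icc in *; lra]. }
  (* The velocity being nonincreasing, its sign at time 0 decides between the two cases. *)
  destruct (Rle_lt_dec (z' 0) 0) as [H|H].
  + left; intros t Ht; rewrite VZ by exact Ht.
    pose proof (z'_decr 0 t ltac:(lra) (proj1 Ht) (proj2 Ht)); nra.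
  + right; split; [|now apply nonincreasing_sign_changes].
    (* The mean slope of [z] is [- 1 / T], so [z'] is negative at some [c]; together with [z' 0 > 0]
       this is a sign change. *)
    destruct (MVT_gen z 0 T z') as [c [Hc E]];
      [intros; apply Hz | intros; apply continuous_continuity_pt; continuity_R |].
    rewrite Rmin_left, Rmax_right in Hc by lra.
    rewrite z0, zT in E.
    assert (zc : z' c < 0) by nra.
    assert (c0 : 0 < c) by (destruct (Req_dec c 0) as [->|]; lra).
    exists (fun i => match i with O => 0 | _ => c end); split.
    * intros [|i] _; unfold Icc; lra.
    * intros i Hi; replace i with 0%nat by lia; split; [exact c0|].
      rewrite !VZ by (unfold Icc; lra).
      replace (Q * z' 0 * (Q * z' c)) with (- (Q * Q * (z' 0 * - z' c))) by ring.
      assert (0 < Q * Q * (z' 0 * - z' c)) by (repeat apply Rmult_lt_0_compat; lra).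
      lra.
- intros Hmon [Q' [xi [HQ' [Hxi Hlt]]]].
  destruct (Xi_scaled z z' z'' T Q' hT Hz Hz' Cz z0 zT) as [HZ' VZ'].
  apply (Rbar_lt_not_le _ _ Hlt).
  (* The unrestricted maximizer for [Q'] is itself monotonic, because [z' <= 0] follows from the
     case of [Q]; the supremum therefore dominates every [J] value over [Xi T Q']. *)
  apply Rbar_le_trans with (Finite (J T eta theta (fun t => Q' * z t))).
  + apply (opt Q' xi Hxi).
  + apply Lub_Rbar_correct; exists (fun t => Q' * z t).
    split; [exact HZ'|split; [|reflexivity]].
    intros t Ht; pose proof (Hmon t Ht) as H.
    rewrite VZ in H by exact Ht; rewrite VZ' by exact Ht.
    assert (z' t <= 0) by nra; nra.
- exact Hconc.
- intros t Ht; unfold TWAP.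
  assert (Hl : 0 <= 1 - t / T <= 1).
  { destruct Ht as [t0 tT].
    assert (0 <= t / T) by now apply Rdiv_le_0_compat.
    assert (t / T <= 1) by (apply Rle_div_l; lra); lra. }
  (* TWAP is the chord between the endpoints of the graph, and [t] is the convex combination of 0
     and [T] with weight [1 - t / T] on 0. *)
  pose proof (Hconc 0 T (1 - t / T) ltac:(unfold Icc; lra) ltac:(unfold Icc; lra) Hl) as H.
  simpl in H; rewrite z0, zT in H.
  replace ((1 - t / T) * 0 + (1 - (1 - t / T)) * T) with t in H by (field; lra).
  lra.
Qed.
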